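(* Let $\Delta>2$ be an integer and let $T$ be an $n$-vertex tree with maximum degree at least $\Delta$. Then $$F^*(T)\ge (n-\Delta+1)\cdot 2^{\Delta-1}+\Delta-1,$$ with equality if and only if $T\cong T_{n,\Delta}$.
   Context: All graphs are finite and simple. A leaf of a tree is a vertex of degree $1$. A subtree of a tree $T$ is a (nonempty) connected induced subgraph of $T$, and $F^*(T)$ denotes the number of subtrees of $T$ that contain at least one leaf of $T$ (leaf containing subtrees). $P_m$ is the path on $m$ vertices. $T_{n,\Delta}$ is the $n$-vertex tree obtained from $P_{n-\Delta+1}$ by attaching $\Delta-1$ pendant vertices to one endvertex of $P_{n-\Delta+1}$. *)

(* Defs.v *)
(* Plain MathComp; graphs are relations on a finType. *)
From mathcomp Require Import all_boot.

Set Implicit Arguments.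
Unset Strict Implicit.
Unset Printing Implicit Defensive.

Definition simple_graph (V : finType) (e : rel V) : Prop :=
  symmetric e /\ irreflexive e.

Definition degree (V : finType) (e : rel V) (x : V) : nat :=
  #|[set y | e x y]|.

Definition max_degree (V : finType) (e : rel V) : nat :=
  \max_(x : V) degree e x.

Definition induced (V : finType) (e : rel V) (S : {set V}) : rel V :=
  [rel x y | [&& x \in S, y \in S & e x y]].

Definition induced_connected (V : finType) (e : rel V) (S : {set V}) : bool :=
  (S != set0) && [forall x in S, forall y in S, connect (induced e S) x y].

(* [cycle] also accepts the closed walks [::], [:: x] and [:: x; y]; graph
   cycles are those with at least three distinct vertices. *)
Definition acyclic (V : finType) (e : rel V) : Prop :=
  forall c : seq V, 2 < size c -> uniq c -> ~~ cycle e c.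

Definition is_tree (V : finType) (e : rel V) : Prop :=
  [/\ simple_graph e, induced_connected e [set: V] & acyclic e].

Definition leaf (V : finType) (e : rel V) (x : V) : bool := degree e x == 1.

(* An induced subgraph is represented by its vertex set. *)
Definition leaf_subtrees (V : finType) (e : rel V) : {set {set V}} :=
  [set S : {set V} | induced_connected e S & [exists x in S, leaf e x]].

Definition Fstar (V : finType) (e : rel V) : nat := #|leaf_subtrees e|.

Definition path_graph (m : nat) : rel 'I_m :=
  [rel i j : 'I_m | (i.+1 == j :> nat) || (j.+1 == i :> nat)].

Definition attach_pendants (V : finType) (e : rel V) (v : V) (k : nat) :
    rel (V + 'I_k)%type :=
  fun a b => match a, b with
  | inl x, inl y => e x y
  | inl x, inr _ => x == v
  | inr _, inl y => y == v
  | inr _, inr _ => false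
  end.

(* The path has (n - Delta).+1 vertices, which is n - Delta + 1 when
   Delta <= n; as an 'I_m.+1 it has a distinguished endvertex ord0. *)
Definition T_graph (n Delta : nat) :
    rel ('I_(n - Delta).+1 + 'I_(Delta - 1))%type :=
  @attach_pendants 'I_(n - Delta).+1 (@path_graph (n - Delta).+1) ord0
    (Delta - 1).

Definition graph_iso (V W : finType) (e : rel V) (f : rel W) : Prop :=
  exists2 h : V -> W, bijective h & forall x y, f (h x) (h y) = e x y.

(* Main.v *)
Require Import Defs.
From mathcomp Require Import all_boot.
From mathcomp Require Import zify.

(** Root the tree at a vertex [c] of maximum degree d. The branches at [c], one
for each child u, have sizes b_u >= 1 with sum n - 1. Choosing in every branch
either nothing or one vertex, and taking the union of the paths from the chosen
vertices to [c], gives \prod (b_u + 1) different subtrees; as every branch has a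
leaf, at most \prod b_u of them contain no leaf. Besides, each of the n - 1
vertices v <> c gives the leaf containing subtree of all its descendants, which
avoids [c]. Hence ([card_branch_subtrees])

  F* >= \prod (b_u + 1) - \prod b_u + n - 1.

For a fixed number d >= 3 of branches the right-hand side is smallest exactly
when at most one b_u exceeds 1 ([branch_product_bound]); it then equals
(n - d + 1) 2^(d-1) + d - 1, which strictly increases with d
([pow_bound_mono]). This proves the inequality.

In the case of equality d = Delta, at most one branch has more than one vertex,
and the tree has no further leaf containing subtree. The latter excludes two
leaves l, l' in one branch, because the union of the paths from l and l' to [c]
was not counted ([two_leaves_extra_subtree]). So each branch is a path, all but
one of them are single vertices, and the tree is a path with Delta - 1 pendant
vertices at one end ([extremal_broom]). Conversely the leaf containing subtrees of that
graph are listed by an explicit code with (n - Delta + 1) 2^(Delta-1) + Delta - 1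
values ([Fstar_broom]), and F* is invariant under isomorphism. *)

Set Implicit Arguments.
Unset Strict Implicit.
Unset Printing Implicit Defensive.

(** * Rooting a tree *)

Lemma connect_ind_pred (T : finType) (r : rel T) (P : pred T) x y :
  (forall a b, P a -> r a b -> P b) -> connect r x y -> P x -> P y.
Proof.
move=> Pr /connectP[p pp ->]; elim: p x pp => //= z p IHp x /andP[rxz pp] Px.
exact: IHp pp (Pr _ _ Px rxz).
Qed.

Lemma induced_sym (V : finType) (e : rel V) (S : {set V}) :
  symmetric e -> symmetric (induced e S).
Proof. by move=> se x y; rewrite /induced /= se andbCA. Qed.

(** A tree seen from its vertex [c]: [par] sends every other vertex to its
neighbour on the way to [c], and [dep] is the distance to [c]. The convention
[par c = c] makes ancestry the reachability relation [fconnect par]. *)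
Record rooting (V : finType) (e : rel V) (c : V) (par : V -> V)
    (dep : V -> nat) : Prop := Rooting {
  rooting_dep0 : dep c = 0;
  rooting_par0 : par c = c;
  rooting_depS : forall x, x != c -> dep x = (dep (par x)).+1;
  rooting_edge : forall x y,
    e x y = (x != c) && (par x == y) || (y != c) && (par y == x) }.

(** Take for [dep] the length of a shortest walk to [c] and for [par] a
neighbour one step closer. An edge that is not of the form x -- [par x] could
be closed into a cycle through the parent edges, which already connect
everything to [c]; so acyclicity leaves only parent edges. *)
Lemma tree_rooting (V : finType) (e : rel V) (c : V) :
  is_tree e -> exists par dep, rooting e c par dep.
Proof.
case=> -[se ie] /andP[_ /'forall_in_forallP conE] acE.
pose walk x n := [exists p : n.-tuple V, path e x p && (last x p == c)].
have walkP x n : reflect (exists p, [/\ size p = n, path e x p & last x p = c])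
                         (walk x n).
  apply: (iffP existsP) => [[p /andP[pp /eqP lp]]|[p [sp pp lp]]].
    by exists p; rewrite size_tuple.
  by rewrite -sp; exists (in_tuple p); rewrite /= pp lp eqxx.
have walk_ex x : exists n, walk x n.
  have /connectP[p pp lp] : connect e x c.
    have := conE x (in_setT _) c; rewrite in_setT /=.
    by apply: connect_sub => a b /and3P[_ _ /connect1].
  by exists (size p); apply/walkP; exists p.
pose dep x := ex_minn (walk_ex x).
have depP x : walk x (dep x) by rewrite /dep; case: ex_minnP.
have dep_min x n : walk x n -> dep x <= n.
  by rewrite /dep; case: ex_minnP => m _ H /H.
have dep0 : dep c = 0.
  by apply/eqP; rewrite -leqn0; apply: dep_min; apply/walkP; exists [::].
pose par x := if x == c then c else odflt x [pick y | e x y & (dep y).+1 == dep x].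
have parP x : x != c -> e x (par x) /\ (dep (par x)).+1 = dep x.
  move=> xc; rewrite /par (negPf xc).
  case: pickP => [y /andP[-> /eqP] //|no] /=.
  have /walkP[[|y p] [sp pp lp]] := depP x; first by rewrite -lp eqxx in xc.
  move: pp => /= /andP[exy pp].
  have dy : dep y <= size p by apply: dep_min; apply/walkP; exists p.
  have dx : dep x <= (dep y).+1.
    have /walkP[q [sq pq lq]] := depP y.
    by apply: dep_min; apply/walkP; exists (y :: q) => /=; rewrite sq exy.
  have := no y; rewrite exy /= => /eqP; case.
  by move: sp dy dx => /=; lia.
exists par, dep; split=> //; first by rewrite /par eqxx.
  by move=> x /parP[].
pose r := [rel x y | (x != c) && (par x == y) || (y != c) && (par y == x)].
have rs : symmetric r by move=> x y /=; rewrite orbC.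
have re : subrel r e.
  move=> x y /= /orP[] /andP[/parP[H _] /eqP <-] //; by rewrite se.
move=> x y; apply/idP/idP; last exact: re.
move=> exy; apply: contraT => nrxy.
have toc z : connect r z c.
  have [m] := ubnP (dep z); elim: m z => // m IHm z dz.
  have [->|zc] := eqVneq z c; first exact: connect0.
  have [_ dpz] := parP z zc.
  apply: connect_trans (IHm (par z) _); last by lia.
  by apply: connect1; rewrite /= zc eqxx.
have : connect r x y.
  by apply: connect_trans (toc x) _; rewrite (sym_connect_sym rs).
case/connectP=> p0 pp0 lp0.
case/shortenP: pp0 lp0 => p pp up _ lp.
(* A simple path of parent edges cannot be the edge x -- y itself. *)
have sp : 2 < size (x :: p).
  case: p pp up lp => [|z [|z' p]] //=; first by move=> _ _ E; rewrite E ie in exy.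
  by rewrite andbT => rxz _ E; move: nrxy; rewrite E rxz.
have /negP := acE _ sp up; case.
rewrite /= rcons_path -lp se exy andbT.
exact: (sub_path re).
Qed.

(** * Ancestors, descendants and branches *)

Section RootedTree.

Variables (V : finType) (e : rel V) (c : V) (par : V -> V) (dep : V -> nat).
Hypothesis R : rooting e c par dep.

Definition ancestors (v : V) : {set V} := [set u | fconnect par v u].
Definition descendants (u : V) : {set V} := [set v | fconnect par v u].
Definition children (u : V) : {set V} := [set v | (v != c) && (par v == u)].

Lemma edge_sym : symmetric e.
Proof. by move=> x y; rewrite !(rooting_edge R) orbC. Qed.

Lemma edge_par x : x != c -> e x (par x).
Proof. by move=> xc; rewrite (rooting_edge R) xc eqxx. Qed.

Lemma dep_eq0 x : dep x = 0 -> x = c.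
Proof.
by move=> dx; apply/eqP; apply: contraT => xc; rewrite (rooting_depS R xc) in dx.
Qed.

Lemma fconnect_root x : fconnect par x c.
Proof.
have [m] := ubnP (dep x); elim: m x => // m IHm x dx.
have [->|xc] := eqVneq x c; first exact: connect0.
apply: connect_trans (fconnect1 _ _) (IHm _ _).
by rewrite (rooting_depS R xc) in dx.
Qed.

Lemma fconnect_dep x y : fconnect par x y -> x = y \/ dep y < dep x.
Proof.
move=> /iter_findex <-; elim: (findex par x y) => [|k IHk] /=; first by left.
have [E|nc] := eqVneq (iter k par x) c.
  by move: IHk; rewrite E (rooting_par0 R).
right; move: IHk (rooting_depS R nc) => [<- ->|]; [exact: ltnSn|lia].
Qed.

Lemma fconnect_anti x y : fconnect par x y -> fconnect par y x -> x = y.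
Proof. by move=> /fconnect_dep[//|H] /fconnect_dep[//|]; lia. Qed.

(** The ancestors of a vertex form a chain, being iterates of [par]. *)
Lemma fconnect_total v x y :
  fconnect par v x -> fconnect par v y -> fconnect par x y || fconnect par y x.
Proof.
move=> /iter_findex <- /iter_findex <-.
set m := findex _ _ _; set n := findex _ _ _.
by have [mn|/ltnW mn] := leqP m n; apply/orP; [left|right];
  rewrite -(subnK mn) iterD fconnect_iter.
Qed.

Lemma root_fconnect x : fconnect par c x -> x = c.
Proof. by move=> H; apply: fconnect_anti (fconnect_root x) H. Qed.

Lemma root_nondescendant u : u != c -> c \notin descendants u.
Proof. by move=> uc; rewrite inE; apply: contra uc => /root_fconnect ->. Qed.

Lemma fconnect_par x y : fconnect par x y -> x != y -> fconnect par (par x) y.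
Proof.
rewrite fconnect_eqVf => /orP[/eqP -> /eqP //|//].
Qed.

Lemma branch_exists v : v != c -> exists2 u, u \in children c & v \in descendants u.
Proof.
have [m] := ubnP (dep v); elim: m v => // m IHm v dv vc.
have [pv|pc] := eqVneq (par v) c.
  by exists v; rewrite inE ?vc ?pv ?eqxx ?connect0.
have [|u uc] := IHm (par v) _ pc; first by rewrite (rooting_depS R vc) in dv.
by rewrite inE => H; exists u => //; rewrite inE; apply: connect_trans (fconnect1 _ _) H.
Qed.

Lemma branch_uniq u w v : u \in children c -> w \in children c ->
  v \in descendants u -> v \in descendants w -> u = w.
Proof.
rewrite !inE => /andP[uc /eqP pu] /andP[wc /eqP pw] vu vw.
have main a b : b != c -> par a = c -> fconnect par a b -> a = b.
  move=> bc pa ab; apply/eqP; apply: contraT => nab.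
  by have := fconnect_par ab nab; rewrite pa => /root_fconnect E; rewrite E eqxx in bc.
by case/orP: (fconnect_total vu vw) => H; [|symmetry]; apply: main H.
Qed.

(** Every vertex of [S] can climb along [par], inside [S], to the common top
vertex [r]. *)
Lemma rooted_connected (S : {set V}) (r : V) : r \in S ->
  (forall v, v \in S -> v != r -> v != c /\ par v \in S) ->
  induced_connected e S.
Proof.
move=> rS cl; apply/andP; split; first by apply/set0Pn; exists r.
have isym := sym_connect_sym (induced_sym S edge_sym).
have tor v : v \in S -> connect (induced e S) v r.
  have [m] := ubnP (dep v); elim: m v => // m IHm v dv vS.
  have [->|vr] := eqVneq v r; first exact: connect0.
  have [vc pS] := cl v vS vr.
  apply: connect_trans (IHm (par v) _ pS).
    by apply: connect1; rewrite /induced /= vS pS edge_par.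
  by rewrite (rooting_depS R vc) in dv.
apply/'forall_in_forall_inP => x xS y yS.
by apply: connect_trans (tor x xS) _; rewrite isym tor.
Qed.

Lemma closed_connected (S : {set V}) : c \in S ->
  (forall v, v \in S -> par v \in S) -> induced_connected e S.
Proof. by move=> cS cl; apply: (rooted_connected cS) => v /cl pS ->. Qed.

Lemma ancestors_closed v x : x \in ancestors v -> par x \in ancestors v.
Proof. by rewrite !inE => /connect_trans; apply; apply: fconnect1. Qed.

Lemma descendants_connected v : v != c -> induced_connected e (descendants v).
Proof.
move=> vc; apply: (@rooted_connected _ v); first by rewrite inE connect0.
move=> x xv xnv; split; last by move: xv; rewrite !inE => /fconnect_par; apply.
by apply: contraTneq xv => ->; apply: root_nondescendant.
Qed.

Lemma children_leaf x : x != c -> children x = set0 -> leaf e x.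
Proof.
move=> xc ch0; rewrite /leaf /degree; apply/cards1P; exists (par x).
apply/setP=> y; rewrite !inE (rooting_edge R) xc /= eq_sym.
by have /setP/(_ y) := ch0; rewrite !inE => ->; rewrite orbF.
Qed.

Lemma leaf_children x : x != c -> leaf e x -> children x = set0.
Proof.
move=> xc /cards1P[y /setP Ny].
have py : par x = y by apply/eqP; have := Ny (par x); rewrite !inE edge_par.
apply/setP=> z; rewrite !inE; apply/negP => /andP[zc /eqP pz].
have : z \in [set y] by rewrite -Ny inE (rooting_edge R) zc pz eqxx orbT.
rewrite inE => /eqP E; move: (rooting_depS R zc) (rooting_depS R xc).
by rewrite pz py E; lia.
Qed.

Lemma leaf_descendants x : x != c -> leaf e x -> descendants x = [set x].
Proof.
move=> xc /(leaf_children xc) /setP ch0; apply/setP=> v.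
rewrite !inE; apply/idP/eqP => [|->]; last exact: connect0.
have [m] := ubnP (dep v); elim: m v => // m IHm v dv vx.
apply/eqP; apply: contraT => nvx.
have vc : v != c.
  by apply: contraTneq vx => ->; have := root_nondescendant xc; rewrite inE.
have pv : par v = x.
  apply: IHm (fconnect_par vx nvx).
  by rewrite (rooting_depS R vc) in dv.
by have := ch0 v; rewrite !inE vc pv eqxx.
Qed.

(** A deepest descendant has no child, hence is a leaf. *)
Lemma descendant_leaf v : v != c -> exists2 l, l \in descendants v & leaf e l.
Proof.
move=> vc; have vv : v \in descendants v by rewrite inE connect0.
case: (arg_maxnP dep vv) => l lv lmax; have {}lv : l \in descendants v by exact: lv.
exists l => //.
have lc : l != c by apply: contraTneq lv => ->; apply: root_nondescendant.
apply: children_leaf => //; apply/setP=> x; rewrite !inE.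
apply/negP=> /andP[xc /eqP px].
have : x \in descendants v.
  by move: lv; rewrite -px !inE; apply: connect_trans (fconnect1 _ _).
by move=> /lmax; rewrite (rooting_depS R xc) px /= ltnn.
Qed.

Lemma leaf_subtreesP (S : {set V}) l : induced_connected e S -> l \in S ->
  leaf e l -> S \in leaf_subtrees e.
Proof.
by move=> cS lS ll; rewrite inE cS /=; apply/existsP; exists l; rewrite lS.
Qed.

Lemma card_ancestors v : #|ancestors v| = (dep v).+1.
Proof.
have [m] := ubnP (dep v); elim: m v => // m IHm v dv.
have [vc|vc] := eqVneq v c.
  rewrite vc (rooting_dep0 R); apply/eqP/cards1P; exists c; apply/setP=> x.
  by rewrite !inE; apply/idP/eqP => [/root_fconnect|->] //; apply: connect0.
rewrite (rooting_depS R vc) -IHm; last by rewrite (rooting_depS R vc) in dv.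
have -> : ancestors v = v |: ancestors (par v).
  by apply/setP=> x; rewrite !inE fconnect_eqVf eq_sym.
rewrite cardsU1 inE; case H: (fconnect _ _ _) => //.
by case/fconnect_dep: H; [move=> E; move: (rooting_depS R vc); rewrite E | rewrite (rooting_depS R vc)]; lia.
Qed.

Lemma degree_root : degree e c = #|children c|.
Proof.
by apply: eq_card => x; rewrite !inE (rooting_edge R) eqxx.
Qed.

(** The vertices other than [c] are partitioned by the child of [c] that they
descend from. *)
Lemma sum_branches : \sum_(u in children c) #|descendants u| = #|V|.-1.
Proof.
rewrite -(cardsC1 c) -[RHS]sum1_card.
under eq_bigr do rewrite -sum1_card big_mkcond /=.
rewrite exchange_big [RHS]big_mkcond /=; apply: eq_bigr => v _.
rewrite !inE; case: eqVneq => [->|vc] /=.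
  apply: big1 => u; rewrite inE => /andP[uc _].
  by rewrite (negPf (root_nondescendant uc)).
have [u uc vu] := branch_exists vc.
rewrite (bigD1 u) //= vu big1 // => w /andP[wc].
by case: ifP => // vw /eqP []; apply: branch_uniq wc uc vw vu.
Qed.

End RootedTree.

(** * Subtrees assembled from the branches *)

Section BranchSubtrees.

Variables (V : finType) (e : rel V) (c : V) (par : V -> V) (dep : V -> nat).
Hypothesis R : rooting e c par dep.

Local Notation ancestors := (ancestors par).
Local Notation descendants := (descendants par).
Local Notation ch := (children c par c).

(** A selection chooses at most one vertex in each branch at [c]; the value [c]
itself encodes that nothing is chosen in that branch, and is also the default
outside the children of [c], so that selections correspond exactly to such
choices. *)
Definition selections : {set {ffun V -> V}} :=
  [set f in pfamily c ch (fun u => c |: descendants u)].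

Definition leafy_selections := [set f in selections | [exists u, leaf e (f u)]].

(** The subtree spanned by [c] and the selected vertices. *)
Definition hull (f : {ffun V -> V}) : {set V} := \bigcup_u ancestors (f u).

(** The subtrees counted by the lower bound. The hulls contain [c] and the sets
of descendants of other vertices do not, so the two kinds never coincide. *)
Definition branch_subtrees : {set {set V}} :=
  [set hull f | f in leafy_selections] :|: [set descendants v | v in [set~ c]].

Lemma selectionsP (f : {ffun V -> V}) : reflect
  ((forall u, u \notin ch -> f u = c) /\
   (forall u, u \in ch -> f u \in c |: descendants u)) (f \in selections).
Proof.
rewrite inE; apply: (iffP pfamilyP) => -[H1 H2]; split=> //.
  by move=> u; apply: contraNeq => fu; apply: (subsetP H1).
by apply/subsetP => u; apply: contraLR => /H1 fu; rewrite inE fu eqxx.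
Qed.

Lemma root_hull (f : {ffun V -> V}) : c \in hull f.
Proof. by apply/bigcupP; exists c => //; rewrite inE (fconnect_root R). Qed.

Lemma hull_connected (f : {ffun V -> V}) : induced_connected e (hull f).
Proof.
apply: (closed_connected R (root_hull f)) => v /bigcupP[u _ vu].
by apply/bigcupP; exists u => //; apply: ancestors_closed.
Qed.

Lemma hull_mem (f : {ffun V -> V}) u : f u \in hull f.
Proof. by apply/bigcupP; exists u => //; rewrite inE connect0. Qed.

Lemma hull_branch (f : {ffun V -> V}) u v : f \in selections -> u \in ch -> v \in descendants u ->
  v \in hull f -> fconnect par (f u) v.
Proof.
case/selectionsP=> fc fd uch vu /bigcupP[w _]; rewrite inE => fwv.
have uc : u != c by move: uch; rewrite inE => /andP[].
have fwu : f w \in descendants u.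
  by move: vu; rewrite !inE; apply: connect_trans.
have fwc : f w != c by apply: contraTneq fwu => ->; apply: root_nondescendant R _ uc.
have wch : w \in ch by apply: contraNT fwc => /fc ->.
have := fd w wch; rewrite in_setU1 (negPf fwc) /= => fww.
by rewrite (branch_uniq R uch wch fwu fww).
Qed.

(** A selection is recovered from its hull: the chosen vertex of a branch is the
lowest vertex that the hull has there. *)
Lemma hull_inj : {in selections &, injective hull}.
Proof.
move=> f g fS gS E; apply/ffunP => u.
have [/selectionsP[fc fd] /selectionsP[gc gd]] := (fS, gS).
have [uch|uch] := boolP (u \in ch); last by rewrite fc // gc.
have half (f' g' : {ffun V -> V}) : f' \in selections -> g' \in selections -> hull f' = hull g' ->
    fconnect par (g' u) (f' u).
  move=> f'S g'S E'; have /selectionsP[_ /(_ u uch)] := f'S.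
  rewrite in_setU1 => /orP[/eqP ->|fu]; first exact: (fconnect_root R).
  by apply: hull_branch g'S uch fu _; rewrite -E' hull_mem.
by apply: (fconnect_anti R); apply: half.
Qed.

Lemma descendants_inj : injective descendants.
Proof.
move=> x y E; have H z : z \in descendants z by rewrite inE connect0.
by apply: (fconnect_anti R); [have := H x; rewrite E | have := H y; rewrite -E]; rewrite inE.
Qed.

Lemma foldr_mul_image (P : {set V}) (F : V -> nat) :
  foldr muln 1 [seq F u | u in P] = \prod_(u in P) F u.
Proof.
rewrite -big_enum /image_mem; elim: (enum P) => [|x s IHs]; first by rewrite big_nil.
by rewrite big_cons /= IHs.
Qed.

Lemma card_selections : #|selections| = \prod_(u in ch) #|descendants u|.+1.
Proof.
rewrite cardsE card_pfamily foldr_mul_image; apply: eq_bigr => u.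
by rewrite inE => /andP[uc _]; rewrite cardsU1 (root_nondescendant R uc).
Qed.

(** Each branch contains a leaf, so a selection without leaves has at most
[#|descendants u|] values to choose from in the branch of [u] instead of one
more. *)
Lemma card_leafy_selections :
  #|selections| <= #|leafy_selections| + \prod_(u in ch) #|descendants u|.
Proof.
rewrite -(cardsID [set f : {ffun V -> V} | [exists u, leaf e (f u)]] selections).
apply: leq_add; first by apply: subset_leq_card; apply/subsetP=> f; rewrite !inE.
pose G u := [set v in c |: descendants u | ~~ leaf e v].
have sub : selections :\: [set f : {ffun V -> V} | [exists u, leaf e (f u)]]
    \subset [set f in pfamily c ch (fun u => G u)].
  apply/subsetP=> f; rewrite in_setD inE negb_exists => /andP[/forallP nl].
  case/selectionsP=> fc fd; rewrite inE; apply/pfamilyP; split.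
    by apply/subsetP => u; apply: contraLR => /fc fu; rewrite inE fu eqxx.
  by move=> u uch; apply/setIdP; split; [exact: fd | exact: nl].
apply: leq_trans (subset_leq_card sub) _.
rewrite cardsE card_pfamily foldr_mul_image; apply: leq_prod => u.
rewrite inE => /andP[uc _]; have [l lu ll] := descendant_leaf R uc.
have /subset_leq_card/leq_trans -> // : G u \subset (c |: descendants u) :\ l.
  apply/subsetP=> v; rewrite inE => /andP[vu nl]; rewrite in_setD1 vu andbT.
  by apply: contraNneq nl => ->.
have := cardsD1 l (c |: descendants u).
by rewrite cardsU1 (root_nondescendant R uc) in_setU1 lu orbT; lia.
Qed.

Lemma card_branch_subtrees :
  \prod_(u in ch) #|descendants u|.+1 + #|V|.-1 <=
  #|branch_subtrees| + \prod_(u in ch) #|descendants u|.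
Proof.
rewrite -card_selections /branch_subtrees.
rewrite cardsU; set I := _ :&: _.
have -> : I = set0.
  apply/setP=> S; rewrite !inE; apply/negP=> /andP[/imsetP[f _ ->] /imsetP[v]].
  rewrite !inE => vc E; have := root_hull f.
  by rewrite E (negPf (root_nondescendant R vc)).
rewrite cards0 subn0 (card_imset _ descendants_inj) cardsC1 card_in_imset.
  by rewrite addnAC leq_add2r card_leafy_selections.
by move=> f g /setIdP[fS _] /setIdP[gS _]; apply: hull_inj.
Qed.

Lemma branch_subtrees_sub : branch_subtrees \subset leaf_subtrees e.
Proof.
apply/subsetP=> S /setUP[] /imsetP[].
  move=> f /setIdP[_ /existsP[u lu]] ->.
  exact: leaf_subtreesP (hull_connected f) (hull_mem f u) lu.
move=> v vC ->; have vc : v != c by move: vC; rewrite !inE.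
have [l lv ll] := descendant_leaf R vc.
exact: leaf_subtreesP (descendants_connected R vc) lv ll.
Qed.

(** The source of strictness. Two leaves in one branch span with [c] a subtree
that is no hull, as a hull meets each branch in a single path, and no set of
descendants, as it contains [c]. *)
Lemma two_leaves_extra_subtree u l l' : ~~ leaf e c -> u \in ch -> l \in descendants u ->
  l' \in descendants u -> leaf e l -> leaf e l' -> l != l' ->
  ancestors l :|: ancestors l' \in leaf_subtrees e :\: branch_subtrees.
Proof.
move=> cNleaf uch lu l'u ll ll' nll'.
have cS x : c \in ancestors x by rewrite inE (fconnect_root R).
rewrite in_setD; apply/andP; split; last first.
  apply: (@leaf_subtreesP _ _ _ l) => //; last by rewrite !inE connect0.
  apply: (closed_connected R); first by rewrite inE cS.
  by move=> v /setUP[] H; apply/setUP; [left|right]; apply: ancestors_closed.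
apply/negP=> /setUP[] /imsetP[]; last first.
  move=> v; rewrite !inE => vc /setP/(_ c); rewrite inE cS.
  by rewrite (negPf (root_nondescendant R vc)).
move=> f /setIdP[fS _] E.
have top x : x \in descendants u -> leaf e x -> x \in hull f -> f u = x.
  move=> xu lx xf; have := hull_branch fS uch xu xf.
  have xc : x != c by apply: contraNneq cNleaf => <-.
  by have /setP/(_ (f u)) := leaf_descendants R xc lx; rewrite !inE => -> /eqP.
have lf : l \in hull f by rewrite -E in_setU inE connect0.
have l'f : l' \in hull f by rewrite -E in_setU orbC inE connect0.
by case/eqP: nll'; rewrite -[LHS](top l lu ll lf); apply: top.
Qed.

End BranchSubtrees.

(** * The extremal inequality for branch sizes *)

(** The entries of [s] are the branch sizes minus one. For a given number of
branches and a given total, the product of the (size + 1) is smallest when a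
single branch carries all the excess; [1 < count (leq 1) s] says that at least
two branches carry some. *)
Lemma prod_excess_bound (s : seq nat) : 0 < size s ->
  (sumn s + 2) * 2 ^ (size s).-1 + (1 < count (leq 1) s) <= \prod_(x <- s) x.+2.
Proof.
elim: s => // x [|y s] IHs _; first by rewrite big_seq1 /=; nia.
move: IHs => /(_ isT); rewrite (big_cons _ _ x).
set t := y :: s => IHs.
have -> : (size (x :: t)).-1 = (size t).-1.+1 by [].
have -> : sumn (x :: t) = x + sumn t by [].
have -> : count (leq 1) (x :: t) = (0 < x) + count (leq 1) t by [].
have ct : 0 < count (leq 1) t -> 0 < sumn t.
  elim: (t) => // z r IHr /=; case: z => //=.
move: IHs; rewrite expnS; have : 0 < 2 ^ (size t).-1 by rewrite expn_gt0.
move: (2 ^ _) (\prod_(_ <- _) _) (sumn t) (count _ t) ct => p P S k ct p0 H.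
have [->|x0] := posnP x.
  by rewrite !add0n; case: (1 < k) H => /=; nia.
have [k0|k0] := posnP k; first by rewrite k0 /= in H *; nia.
have := ct k0; have := leq_b1 (1 < (0 < x) + k); nia.
Qed.

(** The same extremal principle for the number of selections that contain a
leaf, [\prod x.+2 - \prod x.+1]. Two branches are excluded from the strict
part because (x+2)(y+2) - (x+1)(y+1) depends on x + y only. Since
(x+2)P - (x+1)Q = (x+1)(P - Q) + P, the induction also uses the bound on the
product P alone. *)
Lemma prod_difference_bound (s : seq nat) : 0 < size s ->
  \prod_(x <- s) x.+1 + (sumn s + 2) * 2 ^ (size s).-1 +
    ((2 < size s) && (1 < count (leq 1) s)) <=
  \prod_(x <- s) x.+2 + (sumn s).+1.
Proof.
elim: s => // x [|y s] IHs _; first by rewrite !big_seq1 /=; lia.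
move: IHs => /(_ isT); rewrite !(big_cons _ _ x); set t := y :: s => IHs.
have := prod_excess_bound (isT : 0 < size t).
have -> : (size (x :: t)).-1 = (size t).-1.+1 by [].
have -> : sumn (x :: t) = x + sumn t by [].
have -> : count (leq 1) (x :: t) = (0 < x) + count (leq 1) t by [].
have -> : (2 < size (x :: t)) = (1 < size t) by [].
have ct : 0 < count (leq 1) t -> 0 < sumn t.
  elim: (t) => // z r IHr /=; case: z => //=.
have p2 : 1 < size t -> 1 < 2 ^ (size t).-1.
  by move=> s1; rewrite -{1}(expn0 2) ltn_exp2l // -subn1 subn_gt0.
move: IHs; rewrite expnS; have : 0 < 2 ^ (size t).-1 by rewrite expn_gt0.
move: (2 ^ _) (\prod_(_ <- _) _) (\prod_(_ <- _) _) (sumn t) (count _ t) ct p2 =>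
  p P Q S k ct p2 p0.
set e1 : nat := _ && _ => H; set e2 : nat := (1 < k) => A.
set e3 : nat := _ && _.
(* What remains once x.+1 times the inductive bound and one copy of the
   previous lemma's bound have been added up: e2 pays for the strictness if [t]
   has two positive entries, and x * S * (p - 1) does if x and exactly one entry
   of [t] are positive. *)
have key : e3 + x * S <= x * S * p + e2.
  rewrite /e3 /e2; have [k2|k2] := leqP 2 k; first by have := leq_b1 ((1 < size t) && (1 < (0 < x) + k)); nia.
  case: leqP => /= [_|s1]; first by nia.
  have {}p2 := p2 s1.
  have [x0|x0] := posnP x; first by rewrite x0; lia.
  have [k0|k0] := posnP k; first by rewrite k0; nia.
  have := ct k0; have := leq_b1 (1 < (0 < x) + k); nia.
have : x.+1 * (Q + (S + 2) * p + e1) <= x.+1 * (P + S.+1) by rewrite leq_mul2l H orbT.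
rewrite mulnDl; nia.
Qed.

(** The lower bound strictly increases with the degree, so that a vertex of
maximum degree may be used as root even if this exceeds [D]. *)
Lemma pow_bound_mono (D d n : nat) : 0 < D -> D <= d -> d < n ->
  (n - D + 1) * 2 ^ (D - 1) + (D - 1) + (D < d) <=
  (n - d + 1) * 2 ^ (d - 1) + (d - 1).
Proof.
move=> D0 Dd; elim: d Dd => [|d IHd]; first by lia.
rewrite leq_eqVlt => /predU1P[<-|Dd] dn; first by rewrite ltnn addn0.
have := IHd Dd (ltnW dn).
have -> : d.+1 - 1 = (d - 1).+1 by lia.
rewrite expnS; have : 0 < 2 ^ (d - 1) by rewrite expn_gt0.
move: (2 ^ (d - 1)) (2 ^ (D - 1)) => p q; nia.
Qed.

Lemma branch_product_bound (I : finType) (A : {set I}) (b : I -> nat) (n : nat) :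
  (forall u, u \in A -> 0 < b u) -> 2 < #|A| -> \sum_(u in A) b u = n.-1 ->
  \prod_(u in A) b u + (n - #|A| + 1) * 2 ^ (#|A| - 1) +
    (1 < #|[set u in A | 1 < b u]|) <=
  \prod_(u in A) (b u).+1 + (n - #|A|).
Proof.
move=> b0 A2 sb; pose s := [seq (b u).-1 | u <- enum A].
have szs : size s = #|A| by rewrite size_map -cardE.
have -> : \prod_(u in A) b u = \prod_(x <- s) x.+1.
  by rewrite big_map big_enum; apply: eq_bigr => u /b0; case: (b u).
have -> : \prod_(u in A) (b u).+1 = \prod_(x <- s) x.+2.
  by rewrite big_map big_enum; apply: eq_bigr => u /b0; case: (b u).
have -> : #|[set u in A | 1 < b u]| = count (leq 1) s.
  rewrite count_map -size_filter cardE /enum_mem -filter_predI; congr size.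
  by apply: eq_filter => u; rewrite !inE andbC; case: (b u).
have ss : sumn s + #|A| = n.-1.
  rewrite -sb sumnE big_map big_enum /= -sum1_card -big_split /=.
  by apply: eq_bigr => u /b0; case: (b u) => // k _; rewrite addn1.
have := @prod_difference_bound s; rewrite szs A2 /= => /(_ (ltnW (ltnW A2))).
have -> : n - #|A| = (sumn s).+1 by lia.
by rewrite addn1 addn2 subn1; lia.
Qed.

(** * Invariance under isomorphism *)

Section IsoInvariance.

Variables (V W : finType) (e : rel V) (f : rel W) (h : V -> W).
Hypothesis h_bij : bijective h.
Hypothesis h_edge : forall x y, f (h x) (h y) = e x y.

Lemma iso_degree x : degree f (h x) = degree e x.
Proof.
rewrite /degree -(card_imset [set y | e x y] (bij_inj h_bij)).
apply: eq_card => z; have [g hK gK] := h_bij; rewrite -[z]gK.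
by rewrite mem_imset ?inE ?h_edge //; apply: bij_inj.
Qed.

Lemma iso_induced_connected (S : {set V}) :
  induced_connected e S -> induced_connected f (h @: S).
Proof.
case/andP=> /set0Pn[x xS] /'forall_in_forall_inP conS; apply/andP; split.
  by apply/set0Pn; exists (h x); apply: imset_f.
apply/'forall_in_forall_inP => _ /imsetP[a aS ->] _ /imsetP[b bS ->].
apply: (@connect_ind_pred _ (induced e S)
          [pred z | connect (induced f (h @: S)) (h a) (h z)] a b).
- move=> z z' /= az /and3P[zS z'S ezz'].
  apply: connect_trans az (connect1 _).
  by rewrite /induced /= !imset_f //= h_edge.
- exact: conS.
- exact: connect0.
Qed.

Lemma iso_Fstar_le : Fstar e <= Fstar f.
Proof.
rewrite /Fstar -(card_imset (leaf_subtrees e) (imset_inj (bij_inj h_bij))).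
apply: subset_leq_card; apply/subsetP => _ /imsetP[S + ->].
rewrite !inE => /andP[/iso_induced_connected -> /existsP[x /andP[xS lx]]] /=.
by apply/existsP; exists (h x); rewrite imset_f //= /leaf iso_degree.
Qed.

End IsoInvariance.

Lemma connected_pred_ind (V : finType) (e : rel V) (S : {set V}) (P : pred V) x y :
  induced_connected e S -> x \in S -> y \in S -> P x ->
  (forall a b, a \in S -> b \in S -> e a b -> P a -> P b) -> P y.
Proof.
case/andP=> _ /'forall_in_forall_inP conS xS yS Px Pe.
apply: connect_ind_pred (conS x xS y yS) Px => a b Pa /and3P[aS bS eab].
exact: Pe eab Pa.
Qed.

(** * Leaf containing subtrees of a path with pendant vertices *)

Section Broom.

Variables m k : nat.
Hypothesis k_gt0 : 0 < k.

Local Notation broomT := ('I_m.+1 + 'I_k)%type.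

Definition broom : rel broomT :=
  @attach_pendants 'I_m.+1 (@path_graph m.+1) ord0 k.

(** The only leaf on the path is its far end: an inner vertex has two path
neighbours, and the attachment vertex has a pendant one besides its successor,
which needs [0 < k]. *)
Lemma broom_leaf (i : 'I_m.+1) : leaf broom (inl i) -> i = ord_max.
Proof.
move=> li; apply/eqP; apply: contraT => im.
have {}im : i < m.
  by rewrite ltn_neqAle -ltnS ltn_ord andbT; apply: contra im => /eqP E; apply/eqP/val_inj.
pose a : broomT := inl (inord i.+1).
pose b : broomT := if i == ord0 then inr (Ordinal k_gt0) else inl (inord i.-1).
have : [set a; b] \subset [set y | broom (inl i) y].
  apply/subsetP=> y; rewrite !inE => /orP[] /eqP ->.
    by rewrite /a /broom /path_graph /= inordK ?eqxx.
  rewrite /b /broom /path_graph; case: (eqVneq i ord0) => [->|i0] //=.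
  have : 0 < i by rewrite lt0n; apply: contra i0 => /eqP E; apply/eqP/val_inj.
  by have := ltn_ord i; move=> *; rewrite inordK; lia.
move/subset_leq_card; move: li; rewrite /leaf /degree => /eqP ->.
rewrite cards2; suff -> : a != b by [].
rewrite /a /b; case: ifP => // _; apply/eqP => -[] /(congr1 val) /= H.
by have im1 := ltn_ord i; rewrite !inordK in H; lia.
Qed.

(** The leaf containing subtrees of a broom. With [j] the last path vertex and
[K] the set of pendant vertices used, (j, K) encodes the subtree containing
[ord0]; it has a leaf if [K] is nonempty or [j] is the far end. The remaining
pairs (j, set0) with j < m are recycled to encode the subtrees that avoid
[ord0] and reach the far end. What is left are the single pendant vertices. *)
Definition broom_decode (z : ('I_m.+1 * {set 'I_k} + 'I_k)%type) : {set broomT} :=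
  match z with
  | inl (j, K) =>
      if (K != set0) || (j == ord_max)
      then [set inl i | i : 'I_m.+1 & i <= j] :|: [set inr q | q in K]
      else [set inl i | i : 'I_m.+1 & j < i]
  | inr q => [set inr q]
  end.

(** If [l] is missing from [S], the path vertices beyond [l] are separated in
[S] from those before it. *)
Lemma broom_interval (S : {set broomT}) (i j l : 'I_m.+1) :
  induced_connected broom S -> inl i \in S -> inl j \in S -> i <= l <= j ->
  inl l \in S.
Proof.
move=> cS iS jS /andP[il lj]; apply: contraT => lS.
pose P (z : broomT) := if z is inl a then l < a else false.
have Pj : P (inl j).
  by rewrite /P ltn_neqAle lj andbT; apply: contra lS => /eqP/val_inj ->.
suff : P (inl i) by rewrite /P ltnNge il.
apply: connected_pred_ind cS jS iS Pj _ => -[a|a] [b|b] //= aS bS.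
  rewrite /broom /path_graph /=.
  have lb : l != b by apply: contraNneq lS => ->.
  by have : nat_of_ord l != b by []; lia.
by move=> /eqP -> /=; rewrite ltn0.
Qed.

Lemma broom_pendant (S : {set broomT}) (q : 'I_k) :
  induced_connected broom S -> inr q \in S -> inl ord0 \notin S ->
  S = [set inr q].
Proof.
move=> cS qS oS; apply/eqP; rewrite eqEsubset sub1set qS andbT.
apply/subsetP=> y yS; rewrite inE.
apply: (connected_pred_ind (P := pred1 (inr q)) cS qS yS) => [|a b aS bS]; first exact: eqxx.
move=> + /eqP E; rewrite E; case: b bS => [b|b] //= bS /eqP E'.
by rewrite E' (negPf oS) in bS.
Qed.

Lemma broom_leaf_subtrees :
  leaf_subtrees broom \subset [set broom_decode z | z in predT].
Proof.
apply/subsetP=> S; rewrite inE => /andP[cS /existsP[x /andP[xS lx]]].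
have [oS|oS] := boolP (inl ord0 \in S).
  case: (@arg_maxnP _ ord0 [pred i | inl i \in S] (@nat_of_ord _) oS) => j /= jS jmax.
  pose K := [set q | inr q \in S].
  apply/imsetP; exists (inl (j, K)) => //=.
  have -> : (K != set0) || (j == ord_max).
    case: x xS lx => [i|q] xS lx; last first.
      by apply/orP; left; apply/set0Pn; exists q; rewrite inE.
    rewrite (broom_leaf lx) in xS; have := jmax _ xS => /= mj.
    by apply/orP; right; apply/eqP/val_inj/eqP; rewrite eqn_leq -ltnS ltn_ord.
  apply/setP=> -[i|q]; rewrite inE.
    rewrite [X in _ || X](_ : _ = false) ?orbF; last first.
      by apply/negP => /imsetP[].
    rewrite mem_imset ?inE; last by move=> ? ? [].
    apply/idP/idP => [/jmax //|ij]; exact: broom_interval cS oS jS _.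
  rewrite [X in X || _](_ : _ = false) /=; last by apply/negP => /imsetP[].
  by rewrite mem_imset ?inE // => ? ? [].
case: x xS lx => [i|q] xS lx; last first.
  by apply/imsetP; exists (inr q) => //=; apply: broom_pendant.
rewrite (broom_leaf lx) in xS.
case: (@arg_minnP _ ord_max [pred i | inl i \in S] (@nat_of_ord _) xS) => j /= jS jmin.
have j0 : 0 < j.
  by rewrite lt0n; apply: contra oS => /eqP E; rewrite -(_ : j = ord0) //; apply: val_inj.
have jm := ltn_ord j.
apply/imsetP; exists (inl (inord j.-1, set0)) => //=.
have E1 : (inord j.-1 : 'I_m.+1) = j.-1 :> nat by rewrite inordK //; lia.
have -> : (inord j.-1 == ord_max :> 'I_m.+1) = false.
  by apply/eqP => /(congr1 val) /=; rewrite E1; lia.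
rewrite eqxx /=; apply/setP=> -[a|q].
  rewrite mem_imset ?inE; last by move=> ? ? [].
  rewrite E1; have -> : (j.-1 < a) = (j <= a) by lia.
  apply/idP/idP => [/jmin //|ja]; apply: broom_interval cS jS xS _.
  by rewrite ja -ltnS ltn_ord.
rewrite [RHS](_ : _ = false); last by apply/negP => /imsetP[].
apply/negP => qS; have E2 := broom_pendant cS qS oS.
by rewrite E2 inE in xS.
Qed.

Lemma Fstar_broom : Fstar broom <= (m + 1) * 2 ^ k + k.
Proof.
apply: leq_trans (subset_leq_card broom_leaf_subtrees) _.
apply: leq_trans (leq_imset_card _ _) _.
by rewrite card_sum card_prod !card_ord -cardsT -powersetT card_powerset cardsT
  card_ord addn1.
Qed.

End Broom.

(** * Recognising a broom *)

Lemma exists_ord_injection (T : finType) (A : {set T}) (k : nat) :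
  0 < k -> #|A| <= k -> exists g : T -> 'I_k, {in A &, injective g}.
Proof.
move=> k0 Ak; exists (fun v => insubd (Ordinal k0) (index v (enum A))).
have idx v : v \in A -> index v (enum A) < k.
  by move=> vA; apply: leq_trans Ak; rewrite cardE index_mem mem_enum.
move=> x y xA yA /(congr1 val); rewrite !val_insubd !idx //.
by apply: (index_inj x); rewrite mem_enum.
Qed.

Section BroomIso.

Variables (V : finType) (e : rel V) (c : V) (par : V -> V) (dep : V -> nat).
Hypothesis R : rooting e c par dep.

Local Notation ancestors := (ancestors par).

Lemma dep_ancestors_inj l : {in ancestors l &, injective dep}.
Proof.
move=> x y; rewrite !inE => lx ly dxy.
by case/orP: (fconnect_total lx ly) => /(fconnect_dep R)[//|]; lia.
Qed.

(** If all vertices off the path from [l] up to [c] hang at [c], the tree is a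
broom: depth numbers the path, and the edges can be compared because [dep] is
injective on a chain of ancestors. *)
Lemma broom_iso (l : V) (m k : nat) : 0 < k ->
  #|ancestors l| = m.+1 -> #|~: ancestors l| = k ->
  (forall v, v \notin ancestors l -> par v = c) -> graph_iso e (@broom m k).
Proof.
move=> k0 cA cA' pA.
have [g g_inj] : exists g : V -> 'I_k, {in ~: ancestors l &, injective g}.
  by apply: exists_ord_injection; rewrite ?cA'.
have dl v : v \in ancestors l -> dep v < m.+1.
  move=> vl; rewrite -(card_ancestors R) -cA; apply: subset_leq_card.
  by apply/subsetP=> x; move: vl; rewrite !inE; apply: connect_trans.
have cl : c \in ancestors l by rewrite inE (fconnect_root R).
pose h v : 'I_m.+1 + 'I_k :=
  if v \in ancestors l then inl (inord (dep v)) else inr (g v).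
have h_inj : injective h.
  move=> x y; rewrite /h; case: ifPn => xl; case: ifPn => yl // [].
    move=> /(congr1 val); rewrite /= !inordK ?dl //; exact: (dep_ancestors_inj xl yl).
  by apply: g_inj; rewrite inE.
exists h.
  apply: inj_card_bij h_inj _.
  by rewrite card_sum !card_ord -cA -cA' cardsC.
have par_dep x y : x \in ancestors l -> y \in ancestors l ->
    (x != c) && (par x == y) = ((dep y).+1 == dep x).
  move=> xl yl; have [->|xc] := eqVneq x c; first by rewrite (rooting_dep0 R).
  rewrite (rooting_depS R xc) eqSS /=; apply/eqP/eqP => [->//|dxy].
  by apply: (dep_ancestors_inj (ancestors_closed xl) yl).
have root_dep x : x \in ancestors l -> (inord (dep x) == ord0 :> 'I_m.+1) = (c == x).
  move=> xl; rewrite -val_eqE /= inordK ?dl // eq_sym.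
  by apply/eqP/eqP => [/esym/(dep_eq0 R)->|<-] //; rewrite (rooting_dep0 R).
have mix x y : x \in ancestors l -> y \notin ancestors l -> e x y = (c == x).
  move=> xl yl; rewrite (rooting_edge R) (pA y yl).
  have -> : (par x == y) = false.
    by apply: contraNF yl => /eqP <-; apply: ancestors_closed.
  by rewrite andbF; case: (eqVneq y c) yl => [->|//]; rewrite cl.
move=> x y; rewrite /h; case: ifPn => xl; case: ifPn => yl.
- rewrite /broom /path_graph /= !inordK ?dl // (rooting_edge R).
  by rewrite !par_dep // orbC.
- by rewrite /broom /= root_dep // mix.
- by rewrite /broom /= root_dep // (edge_sym R) mix.
rewrite /broom /= (rooting_edge R) !pA //.
have nc v : v \notin ancestors l -> (c == v) = false.
  by apply: contraNF => /eqP <-.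
by rewrite !nc // !andbF.
Qed.

End BroomIso.

(** * The lower bound and its equality case *)

(** Let [u0] head the only branch that may have more than one vertex. As this
branch has a single leaf [l], each of its vertices lies above [l], so the branch
together with [c] is the path from [l] to [c]; the other branches are pendant
vertices. *)
Lemma extremal_broom (V : finType) (e : rel V) (c : V) (par : V -> V)
    (dep : V -> nat) (R : rooting e c par dep) (ch := children c par c) :
  (forall u l l', u \in ch -> l \in descendants par u ->
     l' \in descendants par u -> leaf e l -> leaf e l' -> l = l') ->
  #|[set u in ch | 1 < #|descendants par u|]| <= 1 -> 1 < #|ch| ->
  graph_iso e (@broom (#|V| - #|ch|) (#|ch| - 1)).
Proof.
move=> leaf_uniq one_big ch1.
have [u0 u0ch small] : exists2 u0, u0 \in ch &
    forall u, u \in ch -> u != u0 -> descendants par u = [set u].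
  set B := [set _ in _ | _] in one_big.
  have triv u : u \in ch -> u \notin B -> descendants par u = [set u].
    move=> uch; rewrite inE uch /= -leqNgt => b1; apply/esym/eqP.
    by rewrite eqEcard sub1set inE connect0 cards1.
  have [B0|[u0 u0B]] := set_0Vmem B.
    have /card_gt0P[u0 u0ch] := ltnW ch1.
    by exists u0 => // u uch _; apply: triv => //; rewrite B0 inE.
  exists u0; first by case/setIdP: u0B.
  move=> u uch uu0; apply: triv => //; apply: contra uu0 => uB.
  exact/eqP/(card_le1_eqP one_big).
have u0c : u0 != c by move: u0ch; rewrite inE => /andP[].
have [l lu0 ll] := descendant_leaf R u0c.
have ancE : ancestors par l = c |: descendants par u0.
  apply/setP=> v; rewrite in_setU1; apply/idP/idP.
    case: (eqVneq v c) => //= vc lv; have [w wch vw] := branch_exists R vc.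
    suff <- : w = u0 by [].
    apply: (branch_uniq R wch u0ch _ lu0).
    by move: lv vw; rewrite !inE; apply: connect_trans.
  case/predU1P=> [->|vu0]; first by rewrite inE (fconnect_root R).
  have vc : v != c by apply: contraTneq vu0 => ->; apply: root_nondescendant R _ u0c.
  have [l' l'v ll'] := descendant_leaf R vc.
  have l'u0 : l' \in descendants par u0.
    by move: l'v vu0; rewrite !inE; apply: connect_trans.
  by rewrite (leaf_uniq _ _ _ u0ch lu0 l'u0 ll ll'); move: l'v; rewrite !inE.
have ancC : ~: ancestors par l = ch :\ u0.
  apply/setP=> v; rewrite ancE in_setC in_setU1 in_setD1 negb_or.
  apply/andP/andP=> [[vc vu0]|[vu0 vch]].
    have [w wch vw] := branch_exists R vc.
    have wu0 : w != u0 by apply: contraNneq vu0 => <-.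
    by move: vw; rewrite small // inE => /eqP ->.
  split; first by move: vch; rewrite inE => /andP[].
  apply: contra vu0 => v0; apply/eqP; apply: (branch_uniq R vch u0ch _ v0).
  by rewrite inE connect0.
have cA : #|~: ancestors par l| = #|ch| - 1.
  by rewrite ancC; have := cardsD1 u0 ch; rewrite u0ch => ->; rewrite addKn.
apply: (broom_iso R (l := l)) => //; first by rewrite subn_gt0.
  have := cardsC (ancestors par l); rewrite cA.
  have : 0 < #|ancestors par l| by rewrite (card_ancestors R).
  by lia.
move=> v vl; have : v \in ~: ancestors par l by rewrite inE.
by rewrite ancC => /setD1P[_]; rewrite inE => /andP[_ /eqP].
Qed.

Theorem theorem4p5 (Delta : nat) (hDelta : 2 < Delta) (n : nat)
    (V : finType) (e : rel V) (hn : #|V| = n) (hT : is_tree e)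
    (hdeg : Delta <= max_degree e) :
  (n - Delta + 1) * 2 ^ (Delta - 1) + (Delta - 1) <= Fstar e /\
  (Fstar e = (n - Delta + 1) * 2 ^ (Delta - 1) + (Delta - 1) <->
   graph_iso e (@T_graph n Delta)).
Proof.
have V0 : 0 < #|V|.
  by case: hT => _ /andP[/set0Pn[x _] _] _; apply/card_gt0P; exists x.
have [c hc] := eq_bigmax (degree e) V0.
have {hc hdeg} dc : Delta <= degree e c by rewrite -hc.
have [par [dep R]] := tree_rooting c hT.
have cNleaf : ~~ leaf e c by rewrite /leaf; apply/eqP; lia.
pose ch := children c par c; pose b u := #|descendants par u|.
have chE : degree e c = #|ch| := degree_root R.
have b0 u : u \in ch -> 0 < b u.
  by move=> _; apply/card_gt0P; exists u; rewrite inE connect0.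
have sb : \sum_(u in ch) b u = n.-1 by rewrite -hn (sum_branches R).
have dn : #|ch| < n.
  rewrite -hn -cardsT (cardsD1 c [set: V]) in_setT add1n ltnS.
  by apply: subset_leq_card; apply/subsetP=> v; rewrite !inE => /andP[->].
rewrite chE in dc.
have ch2 : 2 < #|ch| by apply: leq_trans dc.
have D0 : 0 < Delta by lia.
have nums := branch_product_bound b0 ch2 sb.
have mono := pow_bound_mono D0 dc dn.
have cardF := card_branch_subtrees R.
have subF := branch_subtrees_sub R.
have cardD : #|branch_subtrees e c par| +
    #|leaf_subtrees e :\: branch_subtrees e c par| = Fstar e.
  by rewrite /Fstar -(cardsID (branch_subtrees e c par) (leaf_subtrees e)) (setIidPr subF).
rewrite hn in cardF.
(* The three surplus terms vanish exactly for the extremal tree. *)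
have bound : (n - Delta + 1) * 2 ^ (Delta - 1) + (Delta - 1) + (Delta < #|ch|) +
    (1 < #|[set u in ch | 1 < b u]|) +
    #|leaf_subtrees e :\: branch_subtrees e c par| <= Fstar e.
  rewrite -cardD.
  move: nums mono cardF; rewrite -/ch /b.
  set P := \prod_(_ in _) _.+1; set Q := \prod_(_ in _) _.
  set X := _ * 2 ^ (Delta - 1) + _; set Y := _ * 2 ^ (#|ch| - 1).
  by move: (#|branch_subtrees _ _ _|) (#|_ :\: _|) => B D; lia.
move: bound; set X := _ + (Delta - 1) => bound.
have lower : X <= Fstar e by lia.
split=> //.
split=> [FE|[h h_bij h_edge]]; last first.
  apply/eqP; rewrite eqn_leq; apply/andP; split.
    apply: leq_trans (iso_Fstar_le h_bij h_edge) _.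
    by apply: Fstar_broom; rewrite subn_gt0; lia.
  exact: lower.
have [dE one_big no_extra] : [/\ #|ch| = Delta, #|[set u in ch | 1 < b u]| <= 1 &
    leaf_subtrees e :\: branch_subtrees e c par = set0].
  move: bound; rewrite FE; move: (_ :\: _) => D.
  have [-> //|/set0Pn/card_gt0P D1 B] := eqVneq D set0; last by lia.
  by rewrite cards0 => B; split=> //; lia.
rewrite /T_graph -hn -dE.
apply: (extremal_broom R) => //; last by apply: ltnW.
move=> u l l' uch lu l'u ll ll'; apply/eqP; apply: contraT => nll'.
by have := two_leaves_extra_subtree R cNleaf uch lu l'u ll ll' nll'; rewrite no_extra inE.
Qed.
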